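(* Let $(A=KQ/\mathcal I,\le)$ be a 1-quasi-hereditary algebra and $j,k\in Q_0$. For every $i\in Q_0$ with $j\le i$ and $k\le i$, the submodule $\langle p(j,i,k)\rangle=A\cdot p(j,i,k)$ of $P(j)$ satisfies $F(\langle p(j,i,k)\rangle)\subseteq \langle p(j,i,k)\rangle$ for every $F\in\mathrm{End}_A(P(j))$; i.e. $\langle p(j,i,k)\rangle$ is an $\mathrm{End}_A(P(j))^{op}$-submodule of $P(j)$.
   Context: $K$ is an algebraically closed field; $A=KQ/\mathcal I$ is a finite-dimensional basic $K$-algebra given by quiver $Q$ and relations, with vertex set $Q_0=\{1,\dots,n\}$; modules are finite-dimensional left modules. For $i\in Q_0$, $e_i$ is the trivial path, $P(i)=Ae_i$, $I(i)$, $S(i)$ the indecomposable projective, injective, simple modules; for a module $M$, $M_k=e_kM$ and $[M:S(k)]=\dim_K M_k$. Product convention: for arrows $\beta:a\to b$, $\alpha:b\to c$ the path $a\to b\to c$ is $\alpha\cdot\beta$; so a path from $a$ to $b$ lies in $e_bAe_a=P(a)_b$. Given a partial order $\le$ on $Q_0$: the standard module $\Delta(i)$ is the largest factor module of $P(i)$ with $[\Delta(i):S(k)]=0$ for all $k\not\le i$; the costandard module $\nabla(i)$ is the largest submodule of $I(i)$ with $[\nabla(i):S(k)]=0$ for all $k\not\le i$; $\mathfrak F(\Delta)$ is the class of modules with a filtration whose subquotients are standard modules, and $(M:\Delta(i))$ is the (well-defined) number of subquotients isomorphic to $\Delta(i)$. $(A,\le)$ is quasi-hereditary if for all $i,k$: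 $[\Delta(i):S(i)]=1$, $P(i)\in\mathfrak F(\Delta)$, $(P(i):\Delta(k))=0$ for $k\not\le i$, and $(P(i):\Delta(i))=1$. A quasi-hereditary $(A,\le)$ is 1-quasi-hereditary if: (1) $\le$ has a smallest and a largest element, denoted $1$ and $n$; (2) $[\Delta(i):S(j)]=(P(j):\Delta(i))=1$ whenever $j\le i$; (3) $\mathrm{soc}\,P(i)\cong\mathrm{top}\,I(i)\cong S(1)$ for all $i$; (4) for all $i$ there exist a monomorphism $\Delta(i)\hookrightarrow\Delta(n)$ and an epimorphism $\nabla(n)\twoheadrightarrow\nabla(i)$. Write $a\lhd b$ if $a<b$ and no $l$ satisfies $a<l<b$. For a 1-quasi-hereditary algebra it is known that $Q$ has exactly one arrow $a\to b$ and one arrow $b\to a$ whenever $a\lhd b$, and no other arrows. Paths $p(j,i,k)$: for $j,i,k\in Q_0$ with $j\le i$ and $k\le i$, fix a path $p(j,i,i)$ from $j$ to $i$ through vertices $j=\lambda_0\lhd\lambda_1\lhd\dots\lhd\lambda_r=i$ (with $p(i,i,i)=e_i$) and a path $p(i,i,k)$ from $i$ to $k$ through vertices $i=\mu_0\rhd\mu_1\rhd\dots\rhd\mu_m=k$, and set $p(j,i,k):=p(i,i,k)\cdot p(j,i,i)\in P(j)_k$. For an element $p$, $\langle p\rangle:=A\cdot p$.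
   Formalization: In the definition of quasi-hereditary, the condition ''(P(i):Δ(k))=0 for k≰i'' contradicts axiom (2) as soon as there are two vertices ((P(1):Δ(n))=1 although n≰1); it is replaced by the standard condition ''(P(i):Δ(k))=0 unless i≤k''. *)

(* Defs.v *)
(* Finite-dimensional algebras are `falgType K`;
   left modules are "sections" W/U (U <= W subspaces, both A-stable) of a
   K-vector space V equipped with a left A-action act : A -> 'End(V). *)
From HB Require Import structures.
From mathcomp Require Import all_boot all_order all_algebra all_field.
Set Implicit Arguments. Unset Strict Implicit. Unset Printing Implicit Defensive.
Import GRing.Theory.
Local Open Scope ring_scope.

Section Modules.
Variables (K : fieldType) (A : falgType K).

Definition lact (a : A) : 'End(A) := linfun (fun x : A => a * x).
Definition rmul (a : A) : 'End(A) := linfun (fun x : A => x * a).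

Definition DA := 'Hom(A, K^o).
Definition dact (a : A) : 'End(DA) := linfun (fun f : DA => (f \o rmul a)%VF).

Definition Amul (p : A) : {vspace A} := limg (rmul p).

Section Generic.
Variables (V1 V2 : vectType K) (act1 : A -> 'End(V1)) (act2 : A -> 'End(V2)).

Definition submod (U : {vspace V1}) : Prop := forall a, (act1 a @: U <= U)%VS.

(* f : V1 -> V2 induces an A-homomorphism of sections W1/U1 -> W2/U2 *)
Definition is_hom (W1 U1 : {vspace V1}) (W2 U2 : {vspace V2}) (f : 'Hom(V1, V2)) : Prop :=
  (f @: W1 <= W2)%VS /\ (f @: U1 <= U2)%VS /\
  forall a x, x \in W1 -> f (act1 a x) - act2 a (f x) \in U2.

Definition is_mono (W1 U1 : {vspace V1}) (U2 : {vspace V2}) (f : 'Hom(V1, V2)) : Prop :=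
  (W1 :&: f @^-1: U2 <= U1)%VS.

Definition is_epi (W1 : {vspace V1}) (W2 U2 : {vspace V2}) (f : 'Hom(V1, V2)) : Prop :=
  (W2 <= f @: W1 + U2)%VS.

Definition mono_exists W1 U1 W2 U2 : Prop :=
  exists f, is_hom W1 U1 W2 U2 f /\ is_mono W1 U1 U2 f.
Definition epi_exists W1 U1 W2 U2 : Prop :=
  exists f, is_hom W1 U1 W2 U2 f /\ is_epi W1 W2 U2 f.
Definition iso (W1 U1 : {vspace V1}) (W2 U2 : {vspace V2}) : Prop :=
  exists f, [/\ is_hom W1 U1 W2 U2 f, is_mono W1 U1 U2 f & is_epi W1 W2 U2 f].

End Generic.


Section Algebra.
Variables (n : nat) (le : rel 'I_n) (e : 'I_n -> A) (J : {vspace A})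
          (arr : 'I_n -> 'I_n -> seq A).

Definition is_partial_order : Prop :=
  [/\ reflexive le, antisymmetric le & transitive le].

Definition cover (a b : 'I_n) : bool :=
  [&& le a b, a != b &
      ~~ [exists l : 'I_n, [&& le a l, a != l, le l b & l != b]]].

Definition is_jacobson_radical : Prop :=
  forall x : A, x \in J <-> (forall a : A, exists m : nat, (a * x) ^+ m = 0).

Definition J2 : {vspace A} := (J * J)%VS.

(* A = KQ/I with I admissible, with vertices e i and arrows arr a b
   (the arrows a -> b, as elements of e_b A e_a):
   - e is a complete family of orthogonal nonzero idempotents,
   - A/J = K^n via the e i (so A is basic and the e i are primitive),
   - for all a b, the arrows a -> b lie in e_b J e_a and their classes form
     a basis of e_b (J/J^2) e_a. *)
Definition bound_quiver_presentation : Prop :=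
  [/\ is_jacobson_radical,
      [/\ (forall i, e i != 0 /\ e i * e i = e i),
          (forall i j, i != j -> e i * e j = 0) &
          \sum_i e i = 1],
      (forall i (a : A), e i * a * e i \in (<[e i]> + J)%VS),
      (forall i j (a : A), i != j -> e i * a * e j \in J) &
      forall a b,
        [/\ (forall x, x \in arr a b -> x \in J /\ e b * x * e a = x),
            (forall c : seq K, size c = size (arr a b) ->
               \sum_(l < size (arr a b)) c`_l *: (arr a b)`_l \in J2 ->
               forall l, c`_l = 0) &
            (forall x, x \in J ->
               e b * x * e a \in (<<arr a b>>%VS + J2)%VS)]].

Definition Pr (i : 'I_n) : {vspace A} := limg (rmul (e i)).
Definition Inj (i : 'I_n) : {vspace DA} :=                              (* I(i) = D(e_i A) *)
  limg (linfun (fun f : DA => (f \o lact (e i))%VF)).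

Definition cmult (V : vectType K) (act : A -> 'End(V)) (W U : {vspace V}) (k : 'I_n) : nat :=
  (\dim (act (e k) @: W) - \dim (act (e k) @: U))%N.

Definition rad (V : vectType K) (act : A -> 'End(V)) (W : {vspace V}) : {vspace V} :=
  (\sum_(r <- vbasis J) (act r @: W))%VS.

Definition soc (V : vectType K) (act : A -> 'End(V)) (W : {vspace V}) : {vspace V} :=
  (W :&: \bigcap_(r <- vbasis J) lker (act r))%VS.

(* S(i) = top P(i) = P(i) / rad P(i) *)
Definition Sim_top (i : 'I_n) := Pr i.
Definition Sim_bot (i : 'I_n) := rad lact (Pr i).

(* U is the kernel of P(i) -> Delta(i): smallest submodule U of P(i) with
   [P(i)/U : S(k)] = 0 for all k not <= i *)
Definition is_std_kernel (i : 'I_n) (U : {vspace A}) : Prop :=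
  let ok U := [/\ submod lact U, (U <= Pr i)%VS &
                  forall k, ~~ le k i -> cmult lact (Pr i) U k = 0%N] in
  ok U /\ (forall U', ok U' -> (U <= U')%VS).

Definition is_costd (i : 'I_n) (N : {vspace DA}) : Prop :=
  let ok N := [/\ submod dact N, (N <= Inj i)%VS &
                  forall k, ~~ le k i -> cmult dact N 0%VS k = 0%N] in
  ok N /\ (forall N', ok N' -> (N' <= N)%VS).

Section Std.
Variable (Ustd : 'I_n -> {vspace A}).  (* Delta(i) = Pr i / Ustd i *)

Definition is_Dfilt (W : {vspace A}) (M : nat -> {vspace A}) (t : nat) : Prop :=
  [/\ M 0%N = 0%VS, M t = W,
      (forall l, (l <= t)%N -> submod lact (M l)),
      (forall l, (l < t)%N -> (M l <= M l.+1)%VS) &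
      forall l, (l < t)%N -> exists k, iso lact lact (M l.+1) (M l) (Pr k) (Ustd k)].

Definition in_FD (W : {vspace A}) : Prop := exists M t, is_Dfilt W M t.

Definition count_iso (M : nat -> {vspace A}) (t : nat) (k : 'I_n) (m : nat) : Prop :=
  exists s : seq nat, [/\ uniq s, size s = m &
     forall l, l \in s <-> ((l < t)%N /\ iso lact lact (M l.+1) (M l) (Pr k) (Ustd k))].

Definition dmult (W : {vspace A}) (k : 'I_n) (m : nat) : Prop :=
  forall M t, is_Dfilt W M t -> count_iso M t k m.

Definition quasi_hereditary_std : Prop :=
  forall i, [/\ cmult lact (Pr i) (Ustd i) i = 1%N,
               in_FD (Pr i),
               (forall k, ~~ le i k -> dmult (Pr i) k 0) &
               dmult (Pr i) i 1].
End Std.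

Definition one_quasi_hereditary : Prop :=
  [/\ is_partial_order, bound_quiver_presentation &
   exists (Ustd : 'I_n -> {vspace A}) (Nab : 'I_n -> {vspace DA}) (bot top : 'I_n),
   [/\ [/\ (forall i, is_std_kernel i (Ustd i)),
           (forall i, is_costd i (Nab i)) &
           quasi_hereditary_std Ustd],
       (forall i, le bot i /\ le i top),
       (forall i j, le j i ->
          cmult lact (Pr i) (Ustd i) j = 1%N /\ dmult Ustd (Pr j) i 1),
       (forall i, iso lact lact (soc lact (Pr i)) 0%VS (Sim_top bot) (Sim_bot bot)
               /\ iso dact lact (Inj i) (rad dact (Inj i)) (Sim_top bot) (Sim_bot bot)) &
       (forall i, mono_exists lact lact (Pr i) (Ustd i) (Pr top) (Ustd top)
               /\ epi_exists dact dact (Nab top) 0%VS (Nab i) 0%VS)]].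

(* paths p(j,i,i): j = l_0 <| l_1 <| ... <| l_r = i, product of arrows,
   with the convention that x : b -> c after p ending at b gives x * p *)
Inductive up_path : 'I_n -> 'I_n -> A -> Prop :=
| up_nil i : up_path i i (e i)
| up_cons a b c x p : up_path a b p -> cover b c -> x \in arr b c ->
                      up_path a c (x * p).

Inductive down_path : 'I_n -> 'I_n -> A -> Prop :=
| down_nil i : down_path i i (e i)
| down_cons a b c x p : down_path a b p -> cover c b -> x \in arr b c ->
                        down_path a c (x * p).

End Algebra.
End Modules.

(* Main.v *)
(* Write b for the smallest vertex.  Counting composition factors along
   Delta-filtrations gives dim e_i A e_j = #{l | i <= l, j <= l}.  Together with
   the simple socles of A e_i and e_i A this produces, for every i, an element of
   e_i A e_b whose right multiplication is injective on A e_i, and an element d_i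
   of e_b A e_i whose left multiplication is injective on e_i A.  An arrow is not
   in J^2, so comparing with these elements shows that up-paths p from j to i
   cancel on the right and down-paths q from i to k on the left; equality of
   dimensions then gives e_i A e_j = e_i A e_i p and e_b A e_k = d_k (e_k A e_k).
   A nondegenerate pairing e_b A e_i x e_i A e_b -> K, obtained from the socle
   of A e_b, gives e_b A e_i = (e_b A e_b) d for every left-cancelling d.
   An endomorphism of A e_j is right multiplication by some x in e_j A e_j.  Now
   p x = a p with a in e_i A e_i, and d_k q a = r d_k q = d_k c q for some c,
   whence q a = c q and q p x = c q p. *)
Require Import Defs.
From HB Require Import structures.
From mathcomp Require Import all_boot all_order all_algebra all_field zify.
Set Implicit Arguments. Unset Strict Implicit. Unset Printing Implicit Defensive.
Import GRing.Theory.
Local Open Scope ring_scope.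

(** * Cancellation in an abstract ring *)

(** If [s * r = t], then [u = a * r * b] works: a nonzero [z] has a multiple [q * z = s], so
    [q * z * u = t] is nonzero. The ring is arbitrary so that the converse ring [A^c] yields the
    left-handed version. *)
Lemma exists_cancel (R : pzRingType) (a b s t : R) :
  a * a = a -> s != 0 -> b * s = s -> s * a = s -> t != 0 -> t * b = t ->
  (forall z, z * a = z -> z != 0 -> exists r, r * z = s) ->
  (forall z, b * z = z -> z != 0 -> exists r, z * r = t) ->
  b * b = b ->
  exists2 u, a * u * b = u & forall z, z * a = z -> z * u = 0 -> z = 0.
Proof.
move=> aa s0 bs sa t0 tb socs soct bb.
have [r srt] := soct s bs s0.
exists (a * r * b); first by rewrite !mulrA aa -mulrA bb.
move=> z za zu; apply/eqP/negP => /negP z0.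
have [q qz] := socs z za z0.
case/negP: t0; apply/eqP; rewrite -tb -srt -{1}sa -qz -!mulrA.
by rewrite (mulrA a r) zu mulr0.
Qed.

(* [w], the factor of [ui] through [uj], cancels on the right and generates
   [ei R ej] over [ei R ei]; so [x = c * w], and [c] cannot be radical as [x] is
   not in [J2]. *)
Lemma arrow_cancel (R : pzRingType) (J J2 : {pred R}) (ei ej e1 ui uj x : R) :
  (forall y, ei * y * e1 = y -> exists2 z, ei * z * ej = z & y = z * uj) ->
  (forall w, ei * w * ej = w -> (forall z, z * ei = z -> z * w = 0 -> z = 0) ->
     forall y, ei * y * ej = y -> exists2 c, ei * c * ei = c & y = c * w) ->
  ei * ui * e1 = ui -> (forall z, z * ei = z -> z * ui = 0 -> z = 0) ->
  (forall c, ei * c * ei = c ->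
     c \in J \/ forall z, z * ei = z -> z * c = 0 -> z = 0) ->
  (forall w, ei * w * ej = w -> w \in J) ->
  (forall r w, r \in J -> w \in J -> r * w \in J2) ->
  ei * ei = ei -> ei * x * ej = x -> x \notin J2 ->
  forall z, z * ei = z -> z * x = 0 -> z = 0.
Proof.
move=> fac1 fac2 uiE uican loc wJ JJ eiei xE xJ2.
have [w wE uiw] := fac1 _ uiE.
have wcan z : z * ei = z -> z * w = 0 -> z = 0.
  by move=> zE zw; apply: uican => //; rewrite uiw mulrA zw mul0r.
have [c cE xc] := fac2 w wE wcan x xE.
have cei : c * ei = c by rewrite -cE -mulrA eiei.
have [cJ|ccan] := loc c cE; first by case/negP: xJ2; rewrite xc JJ // wJ.
by move=> z zE zx; apply: ccan => //; apply: wcan; rewrite -mulrA ?cei // -xc.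
Qed.

(** * Actions, sections and dimension counts *)

Section Modules.
Variables (K : fieldType) (A : falgType K).

Lemma lactE (a x : A) : lact a x = a * x.
Proof. exact: (lfunE (GRing.mull_fun a idfun)). Qed.

Lemma rmulE (a x : A) : rmul a x = x * a.
Proof. exact: (lfunE (GRing.mulr_fun a idfun)). Qed.

(** [lfunE] asks for a linear structure on the function under [linfun]; the proof builds it for
    precomposition. *)
Lemma linfun_precomp (h : 'End(A)) (f : DA A) :
  linfun (fun f : DA A => (f \o h)%VF) f = (f \o h)%VF.
Proof.
have lin : linear_for *:%R (fun f : DA A => (f \o h)%VF).
  by move=> k g g'; apply/lfunP => y; rewrite !(comp_lfunE, add_lfunE, scale_lfunE).
pose F := GRing.isLinear.Build _ _ _ _ _ lin.
pose G : {linear DA A -> DA A} := HB.pack (fun f : DA A => (f \o h)%VF) F.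
exact: (lfunE G).
Qed.

Lemma dactE a (f : DA A) x : dact a f x = f (x * a).
Proof. by rewrite /dact linfun_precomp comp_lfunE rmulE. Qed.

Lemma mem_limg_rmul (a x : A) : a * a = a ->
  reflect (x * a = x) (x \in limg (rmul a)).
Proof.
move=> aa; apply: (iffP idP) => [/memv_imgP[y _ ->]|xa].
  by rewrite rmulE -mulrA aa.
by apply/memv_imgP; exists x; rewrite ?memvf ?rmulE.
Qed.

(* Applied with [op] the product of [A] and with the opposite product. *)
Lemma exists_annihilated (op : A -> A -> A) (orb : A -> 'End(A)) (J : {vspace A}) :
  (forall s a, orb s a = op a s) -> associative op -> left_id 1 op ->
  (forall x, x \in J -> forall a, exists m, forall s, iter m (op (op a x)) s = 0) ->
  forall s, s != 0 -> exists2 a, op a s != 0 & forall x, x \in J -> op x (op a s) = 0.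
Proof.
move=> orbE opA op1 nilJ s; have [d] := ubnP (\dim (limg (orb s))).
elim: d s => // d IHd s; rewrite ltnS => le_d s0.
have [Js0|] := eqVneq (orb s @: J)%VS 0%VS.
  exists 1; rewrite op1 // => x xJ; apply/eqP.
  by rewrite -memv0 -Js0 -orbE memv_img.
rewrite -vpick0; set y := vpick _ => y0.
have [x xJ yE] : exists2 x, x \in J & y = op x s.
  by have /memv_imgP[x xJ yE] := memv_pick (orb s @: J)%VS; exists x; rewrite // /y yE orbE.
have [|a ay aJ] := IHd y _ y0; last first.
  by exists (op a x) => [|r rJ]; rewrite -opA -yE //; apply: aJ.
apply: leq_trans le_d; rewrite ltn_neqAle.
have sub : (limg (orb y) <= limg (orb s))%VS.
  apply/subvP => _ /memv_imgP[a _ ->]; apply/memv_imgP; exists (op a x).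
    by rewrite memvf.
  by rewrite !orbE yE opA.
rewrite dimvS // andbT (dimv_leqif_eq sub).
(* If [y = x s] generated as much as [s], then [s = a x s] for some [a], and iterating this
   nilpotent map would kill [s]; so the dimension drops strictly. *)
apply: contraNneq s0 => eq_img.
have /memv_imgP[a _] : s \in limg (orb y).
  by rewrite eq_img; apply/memv_imgP; exists 1; rewrite ?memvf ?orbE ?op1.
rewrite orbE yE opA => sE.
have [m axm] := nilJ x xJ a.
have sm p : s = iter p (op (op a x)) s by elim: p => //= p <-.
by rewrite (sm m) axm.
Qed.

(** The map [g] need not be injective on [X]; it only induces an isomorphism [X/X0 -> Y/Y0].
    Rank-nullity is applied to [X] and to [X0], which meet [lker g] in the same space. *)
Lemma dimv_section (V W : vectType K) (g : 'Hom(V, W)) (X X0 : {vspace V})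
    (Y Y0 : {vspace W}) :
  (X0 <= X)%VS -> (Y0 <= Y)%VS -> (g @: X <= Y)%VS -> (g @: X0 <= Y0)%VS ->
  (X :&: g @^-1: Y0 <= X0)%VS -> (Y <= g @: X + Y0)%VS ->
  (\dim X - \dim X0 = \dim Y - \dim Y0)%N.
Proof.
move=> X0X Y0Y gX gX0 mono epi.
have dY : \dim (g @: X + Y0)%VS = \dim Y.
  by apply/eqP; rewrite eqn_leq !dimvS // subv_add gX.
have capE : (g @: X :&: Y0 = g @: X0)%VS.
  apply/eqP; rewrite eqEsubv subv_cap gX0 limgS // !andbT.
  apply/subvP => _ /memv_capP[/memv_imgP[x xX ->] gxY].
  by rewrite memv_img // (subvP mono) // memv_cap xX -memv_preim.
have kerE : (X :&: lker g = X0 :&: lker g)%VS.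
  apply/eqP; rewrite eqEsubv; apply/andP; split; last exact: capvS.
  apply/subvP => x /memv_capP[xX xk]; rewrite memv_cap xk andbT.
  apply: (subvP mono); rewrite memv_cap xX -memv_preim.
  by move: xk; rewrite memv_ker => /eqP->; rewrite mem0v.
have := dimv_sum_cap (g @: X)%VS Y0; rewrite dY capE.
have := limg_ker_dim g X; have := limg_ker_dim g X0; rewrite kerE.
have := dimvS X0X; have := dimvS Y0Y; lia.
Qed.

Lemma memv_idem_img (E : 'End(A)) (U : {vspace A}) (x : A) :
  (forall y, E (E y) = E y) -> x \in (E @: U)%VS -> E x = x.
Proof. by move=> EE /memv_imgP[y _ ->]; rewrite EE. Qed.

Lemma cmult_iso (n : nat) (e : 'I_n -> A) (k : 'I_n) (W1 U1 W2 U2 : {vspace A}) :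
  e k * e k = e k ->
  submod (@lact K A) W1 -> submod (@lact K A) U1 -> (U1 <= W1)%VS ->
  submod (@lact K A) W2 -> submod (@lact K A) U2 -> (U2 <= W2)%VS ->
  iso (@lact K A) (@lact K A) W1 U1 W2 U2 ->
  cmult e (@lact K A) W1 U1 k = cmult e (@lact K A) W2 U2 k.
Proof.
move=> ekk sW1 sU1 UW1 sW2 sU2 UW2 [f [[fW [fU fhom]] mono epi]].
set E := lact (e k).
have EE y : E (E y) = E y by rewrite /E !lactE mulrA ekk.
have smem U y : submod (@lact K A) U -> y \in U -> E y \in U.
  by move=> sU yU; apply: (subvP (sU (e k))); rewrite memv_img.
(* [f] commutes with [e k] only modulo [U2]; composing with [E] gives a map that lands in the
   [e k]-part of [W2]. *)
apply: (@dimv_section _ _ (E \o f)%VF); rewrite ?limgS //.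
- rewrite limg_comp limgS //; apply: subv_trans fW; exact/limgS/sW1.
- rewrite limg_comp limgS //; apply: subv_trans fU; exact/limgS/sU1.
- apply/subvP => x /memv_capP[xE]; rewrite -memv_preim comp_lfunE => Efx.
  have xW : x \in W1 by apply: (subvP (sW1 (e k))).
  have Ex := memv_idem_img EE xE.
  rewrite -Ex memv_img //; apply: (subvP mono); rewrite memv_cap xW -memv_preim.
  have := fhom (e k) x xW; rewrite -/E Ex => fxE.
  by rewrite -[f x](subrK (E (f x))) rpredD // (subvP (sU2 (e k))).
apply/subvP => _ /memv_imgP[y yW ->].
have /memv_addP[_ /memv_imgP[x xW ->] [u uU ->]] := subvP epi y yW.
rewrite linearD /=.
have -> : E (f x) = (E \o f)%VF (E x) - E (f (E x) - E (f x)).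
  by rewrite comp_lfunE linearB /= EE opprB addrC subrK.
rewrite -addrA memv_add ?memv_img // addrC -linearB memv_img // rpredB //.
exact: fhom.
Qed.

(** Nondegeneracy on the side of [Y] makes the rows of the Gram matrix independent, so there are at
    most as many rows as columns. *)
Lemma leq_dim_pairing (phi : {scalar A}) (X Y : {vspace A}) :
  (forall y, y \in Y -> (forall x, x \in X -> phi (x * y) = 0) -> y = 0) ->
  (\dim Y <= \dim X)%N.
Proof.
move=> sep.
pose M := \matrix_(b < \dim Y, a < \dim X) phi ((vbasis X)`_a * (vbasis Y)`_b).
suff: row_free M by move/eqP <-; exact: rank_leq_col.
rewrite -kermx_eq0; apply/eqP/row_matrixP => i; rewrite row0.
set v := row i (kermx M).
have vM : v *m M = 0 by apply/sub_kermxP; exact: row_sub.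
pose y := \sum_b v 0 b *: (vbasis Y)`_b.
have y0 : y = 0.
  apply: sep => [|x xX].
    apply: rpred_sum => b _; apply/rpredZ/vbasis_mem/mem_nth.
    by rewrite size_tuple.
  rewrite (coord_vbasis xX) mulr_suml linear_sum big1 // => a _.
  rewrite -scalerAl linearZ /= /y mulr_sumr linear_sum /=.
  have /rowP/(_ a) := vM; rewrite !mxE => vMa.
  rewrite -[RHS](mulr0 (coord (vbasis X) a x)); congr (_ * _); rewrite -[RHS]vMa.
  by apply: eq_bigr => b _; rewrite !mxE -scalerAr linearZ.
have /freeP/(_ (fun b => v 0 b) y0) vb0 := basis_free (vbasisP Y).
by apply/rowP => b; rewrite [RHS]mxE vb0.
Qed.

End Modules.

(** * Radical, idempotents and arrows of the presentation *)

Section Quiver.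
Variables (K : fieldType) (A : falgType K) (n : nat) (le : rel 'I_n).
Variables (e : 'I_n -> A) (J : {vspace A}) (arr : 'I_n -> 'I_n -> seq A).

Hypothesis presented : bound_quiver_presentation e J arr.

Lemma idem_vertex i : e i * e i = e i.
Proof. by case: presented => _ [/(_ i)[]]. Qed.

Lemma vertex_neq0 i : e i != 0.
Proof. by case: presented => _ [/(_ i)[]]. Qed.

Lemma Jacobson_nil x : x \in J -> forall a, exists m, (a * x) ^+ m = 0.
Proof. by case: presented => /(_ x)[]. Qed.

Lemma Jacobson_mull a x : x \in J -> a * x \in J.
Proof.
move=> xJ; case: presented => /(_ (a * x))[_ mem_J] _ _ _ _.
by apply: mem_J => b; rewrite mulrA; exact: Jacobson_nil.
Qed.

Lemma Jacobson_nilr x : x \in J -> forall a, exists m, (x * a) ^+ m = 0.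
Proof.
move=> xJ a; have [m axm] := Jacobson_nil xJ a; exists m.+1.
have -> : (x * a) ^+ m.+1 = x * (a * x) ^+ m * a.
  elim: m {axm} => [|m IHm]; first by rewrite expr1 expr0 mulr1.
  by rewrite exprS IHm (exprS _ m) !mulrA.
by rewrite axm mulr0 mul0r.
Qed.

Lemma Jacobson_mulr a x : x \in J -> x * a \in J.
Proof.
move=> xJ; case: presented => /(_ (x * a))[_ mem_J] _ _ _ _.
apply: mem_J => b; rewrite mulrA; apply: Jacobson_nilr.
exact: Jacobson_mull.
Qed.

Lemma local_vertex i c :
  e i * c * e i = c -> exists k r, r \in J /\ c = k *: e i + r.
Proof.
move=> <-; case: presented => _ _ /(_ i c) + _ _.
by case/memv_addP => _ /vlineP[k ->] [r rJ ->]; exists k, r.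
Qed.

Lemma Jacobson_offdiag i j c : i != j -> e i * c * e j = c -> c \in J.
Proof. by move=> ij <-; case: presented => _ _ _ /(_ i j c ij). Qed.

Lemma mem_Pr i x : reflect (x * e i = x) (x \in Pr e i).
Proof. exact: mem_limg_rmul (idem_vertex i). Qed.

Lemma mem_peirce i j x :
  reflect (e i * x * e j = x) (x \in (lact (e i) @: Pr e j)%VS).
Proof.
apply: (iffP idP) => [/memv_imgP[y /mem_Pr yj ->]|xE].
  by rewrite lactE -!mulrA yj mulrA idem_vertex.
apply/memv_imgP; exists (x * e j); last by rewrite lactE mulrA.
by apply/mem_Pr; rewrite -mulrA idem_vertex.
Qed.

Lemma arr_notin_J2 i j x : x \in arr i j -> x \notin J2 J.
Proof.
move=> x_arr; apply/negP => xJ2.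
case: presented => _ _ _ _ /(_ i j)[_ indep _].
have lt_x : (index x (arr i j) < size (arr i j))%N by rewrite index_mem.
(* Coefficient 1 at the position of [x] and 0 elsewhere: a relation modulo [J2], against the
   independence of the arrows. *)
pose c : seq K := mkseq (fun l => (l == index x (arr i j))%:R) (size (arr i j)).
have cE l : (l < size (arr i j))%N -> c`_l = (l == index x (arr i j))%:R.
  by move=> lt_l; rewrite nth_mkseq.
suff /(indep c (size_mkseq _ _))/(_ (index x (arr i j)))/eqP : 
    \sum_(l < size (arr i j)) c`_l *: (arr i j)`_l \in J2 J.
  by rewrite cE // eqxx oner_eq0.
rewrite (bigD1 (Ordinal lt_x)) //= cE // eqxx scale1r nth_index //.
rewrite big1 ?addr0 // => l lx; rewrite cE //.
by move: lx; rewrite -val_eqE /= => /negPf->; rewrite scale0r.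
Qed.

Lemma mem_rad_Pr i x :
  reflect (x \in J /\ x * e i = x) (x \in Defs.rad J (@lact K A) (Pr e i)).
Proof.
apply: (iffP idP) => [|[xJ xi]].
  rewrite /Defs.rad big_seq; move: x; elim/big_ind: _ => [x|U V IHU IHV x|r rJ x].
  - by rewrite memv0 => /eqP->; rewrite mem0v mul0r.
  - case/memv_addP=> u /IHU[uJ ui] [v /IHV[vJ vi] ->].
    by rewrite mulrDl ui vi rpredD.
  case/memv_imgP=> y /mem_Pr yi ->; rewrite lactE -mulrA yi.
  by split=> //; apply: Jacobson_mulr; exact: vbasis_mem rJ.
rewrite -xi (coord_vbasis xJ) mulr_suml; apply: rpred_sum => l _.
rewrite -scalerAl rpredZ // /Defs.rad big_tuple.
apply: (subvP (sumv_sup l _ (subvv _))) => //.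
rewrite -(tnth_nth 0) -lactE memv_img //.
by apply/mem_Pr; exact: idem_vertex.
Qed.

Lemma top_Pr b y : y \in Pr e b ->
  exists k, y - k *: e b \in Defs.rad J (@lact K A) (Pr e b).
Proof.
move=> /mem_Pr yb.
have [k [r [rJ ybE]]] : exists k r, r \in J /\ e b * y * e b = k *: e b + r.
  by apply: local_vertex; rewrite !mulrA idem_vertex -!mulrA idem_vertex.
exists k; apply/mem_rad_Pr; split; last first.
  by rewrite mulrBl yb -scalerAl idem_vertex.
(* Insert [1 = \sum_l e l] on the left of [y]: the parts with [l != b] are off-diagonal, hence
   radical, and the part at [b] is [k *: e b + r]. *)
have -> : y - k *: e b = \sum_(l | l != b) e l * y * e b + r.
  have [_ [_ _ e1] _ _ _] := presented.
  apply: (canLR (addrK _)); rewrite -addrA [r + _]addrC -ybE addrC.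
  by rewrite -{1}yb -{1}[y]mul1r -e1 !mulr_suml (bigD1 b).
rewrite rpredD // rpred_sum // => l lb.
by apply: (@Jacobson_offdiag l b) => //; rewrite !mulrA idem_vertex -!mulrA idem_vertex.
Qed.

(** * Simple socles of [A e_i] and [e_i A] *)

(** Modulo its radical, [Pr e b] is the line through [e b]; a section embedded there inherits this.
    The action is arbitrary, to cover both the socle of [A e_i] and the top of [I(i)]. *)
Lemma section_of_simple (V : vectType K) (act : A -> 'End(V)) (W U : {vspace V})
    (b : 'I_n) (f : 'Hom(V, A)) :
  is_hom act (@lact K A) W U (Sim_top e b) (Sim_bot e J b) f ->
  is_mono W U (Sim_bot e J b) f ->
  (forall w, w \in W -> act (e b) w \in W) ->
  (forall w, w \in W -> act (e b) w - w \in U) /\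
  (forall w w', w \in W -> w' \in W -> w \notin U -> exists k, w' - k *: w \in U).
Proof.
move=> [fW [fU fhom]] mono Wb.
have inU w : w \in W -> f w \in Sim_bot e J b -> w \in U.
  by move=> wW fw; apply: (subvP mono); rewrite memv_cap wW -memv_preim.
have topf w : w \in W -> exists k, f w - k *: e b \in Sim_bot e J b.
  by move=> wW; apply: top_Pr; apply: (subvP fW); rewrite memv_img.
split=> [w wW|w w' wW w'W wU].
  apply: inU; first by rewrite rpredB ?Wb.
  rewrite linearB /= -(subrK (e b * f w) (f _)) -addrA rpredD //.
    by rewrite -lactE; exact: fhom.
  have [k /mem_rad_Pr[]] := topf w wW; set r := _ - _ => rJ rb.
  have -> : f w = r + k *: e b by rewrite subrK.
  rewrite mulrDr -scalerAr idem_vertex opprD addrACA subrr addr0.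
  apply/mem_rad_Pr; split; last by rewrite mulrBl -mulrA rb.
  by rewrite rpredB // Jacobson_mull.
have [k fk] := topf w wW; have [k' fk'] := topf w' w'W.
have k0 : k != 0.
  by apply: contraNneq wU => k0; apply: inU; move: fk; rewrite // k0 scale0r subr0.
exists (k' / k); apply: inU; first by rewrite rpredB ?rpredZ.
have -> : f (w' - (k' / k) *: w) = (f w' - k' *: e b) - (k' / k) *: (f w - k *: e b).
  rewrite linearB linearZ /= scalerBr scalerA mulfVK // opprB addrA.
  by rewrite subrK.
by rewrite rpredB ?rpredZ.
Qed.

(** Every nonzero [z] in [A e_i] has a nonzero left multiple annihilated by [J], hence in the socle;
    as the socle is a line, a fixed generator [s] is a multiple of each such [z]. *)
Lemma left_socle b i :
  iso (@lact K A) (@lact K A) (soc J (@lact K A) (Pr e i)) 0%VS (Sim_top e b) (Sim_bot e J b) ->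
  exists s, [/\ s != 0, e b * s = s, s * e i = s &
    forall z, z * e i = z -> z != 0 -> exists r, r * z = s].
Proof.
case=> f [fhom fmono _].
have mem_soc w : w * e i = w -> (forall r, r \in J -> r * w = 0) ->
    w \in soc J (@lact K A) (Pr e i).
  move=> wi Jw; rewrite memv_cap; apply/andP; split; first exact/mem_Pr.
  rewrite big_tuple memvE; apply/subv_bigcapP => l _; rewrite -memvE memv_ker lactE.
  by rewrite Jw // vbasis_mem // mem_tnth.
have socP w : w \in soc J (@lact K A) (Pr e i) ->
    w * e i = w /\ forall r, r \in J -> r * w = 0.
  case/memv_capP => /mem_Pr wi; rewrite big_tuple memvE => /subv_bigcapP Jw.
  split=> // r rJ; rewrite (coord_vbasis rJ) mulr_suml big1 // => l _.
  rewrite -scalerAl -(tnth_nth 0) -lactE.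
  by move: (Jw l isT); rewrite -memvE memv_ker => /eqP->; rewrite scaler0.
have [w wW|fixb prop] := section_of_simple fhom fmono.
  have [wi Jw] := socP w wW; rewrite lactE; apply: mem_soc; first by rewrite -mulrA wi.
  by move=> r rJ; rewrite mulrA Jw // Jacobson_mulr.
have kill z : z * e i = z -> z != 0 -> exists2 a, a * z != 0 &
    a * z \in soc J (@lact K A) (Pr e i).
  move=> zi z0.
  have nilJ x : x \in J -> forall a, exists m, forall y, iter m ( *%R (a * x)) y = 0.
    move=> /Jacobson_nil nilx a; have [m axm] := nilx a.
    by exists m => y; rewrite iter_mulr axm mul0r.
  have [a az0 Jaz] := exists_annihilated (@rmulE K A) (@mulrA A) (@mul1r A) nilJ z0.
  by exists a => //; apply: mem_soc; rewrite // -mulrA zi.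
have [a s0 sS] := kill (e i) (idem_vertex i) (vertex_neq0 i).
exists (a * e i); split=> //.
- by apply/eqP; rewrite -subr_eq0 -memv0 -[e b * _]lactE fixb.
- by rewrite -mulrA idem_vertex.
move=> z zi z0; have [r rz0 rzS] := kill z zi z0.
have [|k] := prop (r * z) _ rzS sS; first by rewrite memv0.
by rewrite memv0 subr_eq0 => /eqP->; exists (k *: r); rewrite scalerAl.
Qed.

Lemma mem_Inj i (g : DA A) : reflect (forall x, g (e i * x) = g x) (g \in Inj e i).
Proof.
apply: (iffP idP) => [/memv_imgP[h _ ->] x|gi].
  by rewrite linfun_precomp !comp_lfunE !lactE mulrA idem_vertex.
apply/memv_imgP; exists g; first exact: memvf.
by rewrite linfun_precomp; apply/lfunP => x; rewrite comp_lfunE lactE gi.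
Qed.

Lemma Inj_separates i t : e i * t = t -> t != 0 -> exists2 g, g \in Inj e i & g t = 1.
Proof.
move=> it t0; pose phi : {scalar A} := coord [tuple t] ord0.
exists (linfun (phi : A -> K^o) \o lact (e i))%VF.
  by apply/mem_Inj => x; rewrite !comp_lfunE !lactE mulrA idem_vertex.
rewrite comp_lfunE lactE it lfunE /=.
by have := coord_free (X := [tuple t]) ord0 ord0 => /= ->; rewrite ?seq1_free.
Qed.

(** Links the right socle of [e_i A] with the top of its dual [I(i)]: on radical generators,
    [(r h)(t) = h(t r) = 0]. *)
Lemma rad_Inj_eval i t g :
  (forall r, r \in J -> t * r = 0) -> g \in Defs.rad J (@dact K A) (Inj e i) -> g t = 0.
Proof.
move=> tJ; rewrite /Defs.rad big_seq; move: g.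
elim/big_ind: _ => [g|U V IHU IHV g|r rJ g].
- by rewrite memv0 => /eqP->; rewrite zero_lfunE.
- by case/memv_addP=> u /IHU ut [v /IHV vt ->]; rewrite add_lfunE ut vt addr0.
by case/memv_imgP=> h _ ->; rewrite dactE tJ ?linear0 // vbasis_mem.
Qed.

Lemma right_socle b i :
  iso (@dact K A) (@lact K A) (Inj e i) (Defs.rad J (@dact K A) (Inj e i))
    (Sim_top e b) (Sim_bot e J b) ->
  exists t, [/\ t != 0, t * e b = t, e i * t = t &
    forall z, e i * z = z -> z != 0 -> exists r, z * r = t].
Proof.
case=> f [fhom fmono _].
have [w /mem_Inj wi|fixb prop] := section_of_simple fhom fmono.
  by apply/mem_Inj => x; rewrite !dactE -mulrA wi.
have kill z : e i * z = z -> z != 0 -> exists2 a, z * a != 0 &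
    forall r, r \in J -> z * a * r = 0.
  move=> zi z0.
  apply: (@exists_annihilated K A (fun a z => z * a) (@lact K A)) z0 => //.
  - exact: lactE.
  - by move=> x y w; rewrite mulrA.
  - exact: mulr1.
  move=> x /Jacobson_nilr nilx a; have [m xam] := nilx a; exists m => y.
  have -> : iter m (fun w => w * (x * a)) y = y * (x * a) ^+ m.
    by elim: m {xam} => [|m IHm] /=; rewrite ?mulr1 // IHm exprSr [RHS]mulrA.
  by rewrite xam mulr0.
have [a t0 tJ] := kill (e i) (idem_vertex i) (vertex_neq0 i).
set t := e i * a in t0 tJ.
have it : e i * t = t by rewrite /t mulrA idem_vertex.
have [g gI gt1] := Inj_separates it t0.
have g_rad : g \notin Defs.rad J (@dact K A) (Inj e i).
  by apply: contraTN (oner_neq0 K) => /(rad_Inj_eval tJ); rewrite gt1 => ->; rewrite eqxx.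
exists t; split=> //.
  apply/eqP; rewrite -subr_eq0; apply/negP => /negP tb0.
  have [|h hI h1] := @Inj_separates i _ _ tb0; first by rewrite mulrBr mulrA it.
  case/eqP: (oner_neq0 K); rewrite -[LHS]h1 linearB /=.
  have : (dact (e b) h - h) t = 0 := rad_Inj_eval tJ (fixb h hI).
  by rewrite add_lfunE opp_lfunE dactE.
move=> z iz z0; have [r zr0 zrJ] := kill z iz z0.
(* Modulo the radical of [I(i)] every [h] is a multiple of [g], and the radical vanishes on [t] and
   on [z * r]; so no functional separates the two sides. *)
have zrE : z * r = g (z * r) *: t.
  apply/eqP; rewrite -subr_eq0; apply/negP => /negP d0.
  have [|h hI h1] := @Inj_separates i _ _ d0.
    by rewrite mulrBr -scalerAr it mulrA iz.
  have [k hk] := prop g h gI hI g_rad.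
  have := rad_Inj_eval tJ hk; have := rad_Inj_eval zrJ hk.
  rewrite !add_lfunE !opp_lfunE !scale_lfunE gt1 => /subr0_eq hzr /subr0_eq ht.
  case/eqP: (oner_neq0 K); rewrite -[LHS]h1 linearB linearZ /= hzr ht.
  by rewrite /GRing.scale /= mulr1 mulrC subrr.
have gz0 : g (z * r) != 0 by apply: contraNneq zr0 => gz; rewrite zrE gz scale0r.
exists ((g (z * r))^-1 *: r); rewrite -scalerAr {2}zrE.
by rewrite scalerA mulVf // scale1r.
Qed.

(** * Dimensions of the Peirce components [e_i A e_j] *)

Lemma submod_Pr i : submod (@lact K A) (Pr e i).
Proof.
by move=> a; apply/subvP => _ /memv_imgP[x /mem_Pr xi ->]; apply/mem_Pr; rewrite lactE -mulrA xi.
Qed.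

(** In a filtration of P(j), a layer Delta(k) adds 1 to the dimension when [le i k] and 0 otherwise,
    and there is one such layer when [le j k] and none otherwise. *)
Lemma dim_peirce (Ustd : 'I_n -> {vspace A}) i j :
  is_partial_order le ->
  (forall i, is_std_kernel le e i (Ustd i)) ->
  quasi_hereditary_std le e Ustd ->
  (forall i j, le j i -> cmult e (@lact K A) (Pr e i) (Ustd i) j = 1%N /\
     dmult e Ustd (Pr e j) i 1) ->
  \dim (lact (e i) @: Pr e j) = #|[pred l | le i l && le j l]|.
Proof.
move=> [le_refl anti _] std qh mult1.
have cmultE k l : cmult e (@lact K A) (Pr e k) (Ustd k) l = le l k.
  case: (boolP (le l k)) => [/mult1[]//|lk].
  by have [[_ _ ->]] := std k.
have [_ [M [t filt]] dmult0 _] := qh j.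
have [M0 Mt subM leM facM] := filt.
have facE l k (lt_l : (l < t)%N) m :
    iso (@lact K A) (@lact K A) (M l.+1) (M l) (Pr e k) (Ustd k) ->
    (\dim (lact (e m) @: M l.+1) - \dim (lact (e m) @: M l))%N = le m k.
  have [[sU UP _] _] := std k.
  move=> isok; rewrite -(cmultE k m).
  have := cmult_iso (idem_vertex m) (subM _ lt_l) (subM l (ltnW lt_l)) (leM l lt_l).
  by apply=> //; exact: submod_Pr.
have [f fP] : exists f : 'I_t -> 'I_n, forall l : 'I_t,
    iso (@lact K A) (@lact K A) (M l.+1) (M l) (Pr e (f l)) (Ustd (f l)).
  exact/(fin_all_exists (fun l : 'I_t => facM l (ltn_ord l))).
(* The dimensions of the Peirce parts of a layer recover the set of [m] with [le m k], and
   antisymmetry then recovers [k]. *)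
have f_uniq (l : 'I_t) k :
    iso (@lact K A) (@lact K A) (M l.+1) (M l) (Pr e k) (Ustd k) -> k = f l.
  move=> isok; have eqk m : le m k = le m (f l) :> nat.
    by rewrite -(facE l k (ltn_ord l) m isok) -(facE l _ (ltn_ord l) m (fP l)).
  by apply: anti; have := eqk k; have := eqk (f l); rewrite !le_refl; do 2 case: (le _ _).
have countE k : #|[pred l | f l == k]| = le j k.
  have : dmult e Ustd (Pr e j) k (le j k).
    by case: (boolP (le j k)) => [/mult1[]//|/dmult0].
  move=> /(_ M t filt)[s [s_uniq <- s_iso]].
  rewrite cardE -(size_map val).
  apply/perm_size/uniq_perm => // [|l]; first by rewrite map_inj_uniq ?enum_uniq //; exact: val_inj.
  apply/mapP/idP => [[l' ] | /s_iso[lt_l isok]].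
    by rewrite mem_enum inE => /eqP fl' ->; apply/s_iso; rewrite -fl'; split; [exact: ltn_ord | exact: fP].
  by exists (Ordinal lt_l); rewrite // mem_enum inE (f_uniq (Ordinal lt_l) k).
have dimM m : (m <= t)%N -> \dim (lact (e i) @: M m) =
    (\sum_(l < m) (\dim (lact (e i) @: M l.+1) - \dim (lact (e i) @: M l)))%N.
  elim: m => [|m IHm] lt_m; first by rewrite big_ord0 M0 limg0 dimv0.
  by rewrite big_ord_recr /= -IHm ?subnKC ?dimvS ?limgS ?leM // ltnW.
rewrite -Mt dimM // (eq_bigr (fun l => le i (f l) : nat)) => [|l _]; last exact: facE.
rewrite -sum1_card [RHS]big_mkcond /= (partition_big f xpredT) //=.
apply: eq_bigr => k _; rewrite (eq_bigr (fun=> le i k : nat)) => [|l /eqP<- //].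
by rewrite sum_nat_const countE !inE; case: (le i k); case: (le j k).
Qed.


(** * Cancellable elements *)

Definition rcancel i u := forall z, z * e i = z -> z * u = 0 -> z = 0.
Definition lcancel i u := forall z, e i * z = z -> u * z = 0 -> z = 0.

Lemma peirceP i j x : e i * x * e j = x <-> e i * x = x /\ x * e j = x.
Proof.
split=> [<-|[ix xj]]; last by rewrite ix.
by rewrite !mulrA idem_vertex -!mulrA idem_vertex.
Qed.

(** The corner [e_i A e_i] is local: for [k != 0] the element is [k *: (e i - r')] with [r']
    nilpotent, and [z = z * r'] iterates to [z = 0]. *)
Lemma local_cancel i c : e i * c * e i = c -> c \in J \/ rcancel i c /\ lcancel i c.
Proof.
move=> /local_vertex[k [r [rJ ->]]].
have [->|k0] := eqVneq k 0; [by left; rewrite scale0r add0r | right].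
have [r' r'J rE] : exists2 r', r' \in J & r = - (k *: r').
  exists (- k^-1 *: r); first by rewrite rpredZ.
  by rewrite scaleNr scalerN opprK scalerA mulfV // scale1r.
have [m r'm] : exists m, r' ^+ m = 0.
  by have [m] := Jacobson_nil r'J 1; rewrite mul1r; exists m.
split=> z zi.
  rewrite rE mulrDr mulrN -!scalerAr zi -scalerBr => /eqP.
  rewrite scaler_eq0 (negPf k0) subr_eq0 => /eqP zr.
  have zrm p : z = z * r' ^+ p.
    by elim: p => [|p IHp]; rewrite ?expr0 ?mulr1 // exprSr mulrA -IHp.
  by rewrite (zrm m) r'm mulr0.
rewrite rE mulrDl mulNr -!scalerAl zi -scalerBr => /eqP.
rewrite scaler_eq0 (negPf k0) subr_eq0 => /eqP zr.
have zrm p : z = r' ^+ p * z.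
  by elim: p => [|p IHp]; rewrite ?expr0 ?mul1r // exprS -mulrA -IHp.
by rewrite (zrm m) r'm mul0r.
Qed.

(** Right multiplication by [u] is injective from [e_i A e_j] to [e_i A e_k], so equality of
    dimensions makes it onto. *)
Lemma factor_right i j k u :
  e j * u * e k = u -> rcancel j u ->
  \dim (lact (e i) @: Pr e j) = \dim (lact (e i) @: Pr e k) ->
  forall y, e i * y * e k = y -> exists2 z, e i * z * e j = z & y = z * u.
Proof.
move=> /peirceP[ju uk] ucan dimE y yE.
have imgE : (rmul u @: (lact (e i) @: Pr e j) = lact (e i) @: Pr e k)%VS.
  apply/eqP; rewrite eqEdim -dimE [X in (_ <= X)%N]limg_dim_eq ?leqnn ?andbT.
    apply/subvP => _ /memv_imgP[z /mem_peirce/peirceP[iz _] ->].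
    by apply/mem_peirce/peirceP; rewrite rmulE mulrA iz -mulrA uk.
  apply/eqP; rewrite -subv0; apply/subvP => z /memv_capP[/mem_peirce/peirceP[_ zj]].
  by rewrite memv_ker memv0 rmulE => /eqP /ucan ->.
have /memv_imgP[z /mem_peirce zE ->] : y \in (rmul u @: (lact (e i) @: Pr e j))%VS.
  by rewrite imgE; apply/mem_peirce.
by exists z; rewrite ?rmulE.
Qed.

Lemma factor_left i j k u :
  e j * u * e k = u -> lcancel k u ->
  \dim (lact (e k) @: Pr e i) = \dim (lact (e j) @: Pr e i) ->
  forall y, e j * y * e i = y -> exists2 z, e k * z * e i = z & y = u * z.
Proof.
move=> /peirceP[ju uk] ucan dimE y yE.
have imgE : (lact u @: (lact (e k) @: Pr e i) = lact (e j) @: Pr e i)%VS.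
  apply/eqP; rewrite eqEdim -dimE [X in (_ <= X)%N]limg_dim_eq ?leqnn ?andbT.
    apply/subvP => _ /memv_imgP[z /mem_peirce/peirceP[_ zi] ->].
    by apply/mem_peirce/peirceP; rewrite lactE mulrA ju -mulrA zi.
  apply/eqP; rewrite -subv0; apply/subvP => z /memv_capP[/mem_peirce/peirceP[kz _]].
  by rewrite memv_ker memv0 lactE => /eqP /ucan ->.
have /memv_imgP[z /mem_peirce zE ->] : y \in (lact u @: (lact (e k) @: Pr e i))%VS.
  by rewrite imgE; apply/mem_peirce.
by exists z; rewrite ?lactE.
Qed.

(** * Paths under the dimension formula and simple socles *)

Variable b : 'I_n.
Hypothesis le_po : is_partial_order le.
Hypothesis le_bot : forall i, le b i.
Hypothesis dimE : forall i j,
  \dim (lact (e i) @: Pr e j) = #|[pred l | le i l && le j l]|.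
Hypothesis lsoc : forall i, exists s, [/\ s != 0, e b * s = s, s * e i = s &
  forall z, z * e i = z -> z != 0 -> exists r, r * z = s].
Hypothesis rsoc : forall i, exists t, [/\ t != 0, t * e b = t, e i * t = t &
  forall z, e i * z = z -> z != 0 -> exists r, z * r = t].

(** By transitivity, the common upper bounds of [i] and [j] are those of [i] alone. *)
Lemma dim_up i j : le j i ->
  \dim (lact (e i) @: Pr e j) = #|le i| /\ \dim (lact (e j) @: Pr e i) = #|le i|.
Proof.
case: le_po => _ _ le_trans ji; rewrite !dimE; split; apply: eq_card => l.
  by rewrite !inE; apply: andb_idr; exact: le_trans.
by rewrite !inE; apply: andb_idl; exact: le_trans.
Qed.

Lemma exists_rcancel i : exists2 u, e i * u * e b = u & rcancel i u.
Proof.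
have [s [s0 bs si socs]] := lsoc i; have [t [t0 tb _ soct]] := rsoc b.
exact: exists_cancel (idem_vertex i) s0 bs si t0 tb socs soct (idem_vertex b).
Qed.

Lemma exists_lcancel i : exists2 d, e b * d * e i = d & lcancel i d.
Proof.
have [s [s0 sb is_ socs]] := rsoc i; have [t [t0 bt _ soct]] := lsoc b.
(* In the converse ring the left and right socles trade places. *)
have [d dE dcan] := @exists_cancel A^c (e i) (e b) s t (idem_vertex i) s0 sb is_ t0 bt
  socs soct (idem_vertex b).
by exists d => //; rewrite -mulrA.
Qed.

Lemma arrE i j x : x \in arr i j -> e j * x * e i = x.
Proof. by case: presented => _ _ _ _ /(_ i j)[xE _ _] /xE[]. Qed.

Lemma rcancel_arrow i j x : le j i -> j != i -> x \in arr j i -> rcancel i x.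
Proof.
have [le_refl _ _] := le_po.
move=> ji ij x_arr; have [u uE ucan] := exists_rcancel i.
have [v vE vcan] := exists_rcancel j.
have [dij _] := dim_up ji; have [dib _] := dim_up (le_bot i).
have [dii _] := dim_up (le_refl i).
(* The spaces [e_i A e_j], [e_i A e_b] and [e_i A e_i] all have dimension [#|le i|], which yields
   both required factorisations. *)
apply: (arrow_cancel (J := J) (J2 := J2 J) (ei := e i) (ej := e j) (e1 := e b)
  (ui := u) (uj := v)) => //; last 1 first.
- exact: arr_notin_J2 x_arr.
- exact: factor_right vE vcan (etrans dij (esym dib)).
- move=> w wE wcan; exact: factor_right wE wcan (etrans dii (esym dij)).
- by move=> c /local_cancel[|[]]; [left | right].
- by move=> w; apply: Jacobson_offdiag; rewrite eq_sym.
- by move=> r w; exact: memv_mul.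
- exact: idem_vertex.
- exact: arrE.
Qed.

Lemma lcancel_arrow i j x : le j i -> j != i -> x \in arr i j -> lcancel i x.
Proof.
have [le_refl _ _] := le_po.
move=> ji ij x_arr; have [u uE ucan] := exists_lcancel i.
have [v vE vcan] := exists_lcancel j.
have [_ dji] := dim_up ji; have [_ dbi] := dim_up (le_bot i).
have [dii _] := dim_up (le_refl i).
(* The argument of [rcancel_arrow] in the converse ring, with [e_j A e_i], [e_b A e_i] and
   [e_i A e_i] of equal dimension. *)
apply: (@arrow_cancel A^c (mem J) (mem (J2 J)) (e i) (e j) (e b) u v) => //; last 1 first.
- exact: arr_notin_J2 x_arr.
- move=> y; rewrite /GRing.mul /= mulrA => yE.
  have [z zE yz] := factor_left vE vcan (etrans dji (esym dbi)) yE.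
  by exists z => //; rewrite mulrA.
- move=> w; rewrite /GRing.mul /= mulrA => wE wcan y; rewrite mulrA => yE.
  have [z zE yz] := factor_left wE wcan (etrans dii (esym dji)) yE.
  by exists z => //; rewrite mulrA.
- by rewrite /GRing.mul /= mulrA.
- by move=> c; rewrite /GRing.mul /= mulrA => /local_cancel[|[]]; [left | right].
- by move=> w; rewrite /GRing.mul /= mulrA; apply: Jacobson_offdiag.
- by move=> r w rJ wJ; exact: memv_mul.
- exact: idem_vertex.
- by rewrite /GRing.mul /= mulrA arrE.
Qed.

Lemma up_path_cancel j i p : up_path le e arr j i p ->
  [/\ le j i, e i * p * e j = p & rcancel i p].
Proof.
have [le_refl _ le_trans] := le_po.
elim=> {j i p} [i|a c d x p _ [ac /peirceP[cp pa] pcan] /and3P[cd neq_cd _] x_arr].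
  split=> [||z zi]; [exact: le_refl | by rewrite !idem_vertex | by rewrite zi].
have /peirceP[dx xc] := arrE x_arr.
split; first exact: le_trans cd.
  by apply/peirceP; rewrite mulrA dx -mulrA pa.
move=> z zd; rewrite mulrA => zxp; apply: (rcancel_arrow cd neq_cd x_arr) => //.
by apply: pcan; rewrite // -mulrA xc.
Qed.

Lemma down_path_cancel i k p : down_path le e arr i k p ->
  [/\ le k i, e k * p * e i = p & lcancel i p].
Proof.
have [le_refl _ le_trans] := le_po.
elim=> {i k p} [i|a c d x p _ [ca /peirceP[cp pa] pcan] /and3P[dc neq_dc _] x_arr].
  split=> [||z zi]; [exact: le_refl | by rewrite !idem_vertex | by rewrite zi].
have /peirceP[dx xc] := arrE x_arr.
split; first exact: le_trans ca.
  by apply/peirceP; rewrite mulrA dx -mulrA pa.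
move=> z za; rewrite -mulrA => xpz; apply: pcan => //.
by apply: (lcancel_arrow dc neq_dc x_arr); rewrite // mulrA cp.
Qed.

(** As [e_b A e_b] and [e_b A e_i] may differ in dimension, surjectivity of [a -> a * d] comes from
    pairing its image with [e_i A e_b] by [phi (x * z)]. This separates: for [z != 0] the nonzero
    [d * z] has [s] as a left multiple. *)
Lemma bot_factor_left i d : e b * d * e i = d -> lcancel i d ->
  forall y, e b * y * e i = y -> exists2 a, e b * a * e b = a & y = a * d.
Proof.
move=> /peirceP[bd di] dcan y yE; have [s [s0 bs sb socs]] := lsoc b.
(* A linear functional with value 1 at the socle generator [s]. *)
pose phi : {scalar A} := coord [tuple s] ord0.
have phis : phi s != 0.
  have := coord_free (X := [tuple s]) ord0 ord0 => /= ->; last by rewrite seq1_free.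
  by rewrite oner_eq0.
have imgE : (rmul d @: (lact (e b) @: Pr e b) = lact (e b) @: Pr e i)%VS.
  apply/eqP; rewrite eqEdim; apply/andP; split.
    apply/subvP => _ /memv_imgP[z /mem_peirce/peirceP[bz zb] ->].
    by apply/mem_peirce/peirceP; rewrite rmulE mulrA bz -mulrA di.
  have [dib dbi] := dim_up (le_bot i); rewrite dbi -dib.
  apply: (leq_dim_pairing (phi := phi)) => z /mem_peirce/peirceP[iz zb] phi0.
  apply: dcan => //; apply/eqP/negP => /negP dz0.
  have [|r rdz] := socs (d * z) _ dz0; first by rewrite -mulrA zb.
  case/eqP: phis; rewrite -(phi0 (e b * r * e b * d)).
    by rewrite -!mulrA (mulrA (e b) d) bd rdz bs.
  rewrite -rmulE memv_img //; apply/mem_peirce/peirceP.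
  by rewrite !mulrA idem_vertex -!mulrA idem_vertex.
have /memv_imgP[a /mem_peirce aE ->] : y \in (rmul d @: (lact (e b) @: Pr e b))%VS.
  by rewrite imgE; apply/mem_peirce.
by exists a; rewrite ?rmulE.
Qed.

(** The identity is proved after multiplying by [d], since [bot_factor_left] lives in the row of
    [b]: [d p a = r d p] and [r d = d c], then [d] cancels. *)
Lemma down_commutes i k p a : le k i -> e k * p * e i = p -> lcancel i p ->
  e i * a * e i = a -> exists c, p * a = c * p.
Proof.
have [le_refl _ _] := le_po.
move=> ki /peirceP[kp pi] pcan /peirceP[ia ai].
have [d /[dup] dE /peirceP[bd dk] dcan] := exists_lcancel k.
have dpE : e b * (d * p) * e i = d * p.
  by apply/peirceP; rewrite mulrA bd -mulrA pi.
have dpcan : lcancel i (d * p).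
  move=> z iz; rewrite -mulrA => dpz; apply: pcan => //; apply: dcan => //.
  by rewrite mulrA kp.
have [|r /peirceP[br rb] dpa] := bot_factor_left dpE dpcan (y := d * p * a).
  by apply/peirceP; rewrite -!mulrA ai !mulrA bd.
have [_ dbk] := dim_up (le_bot k); have [dkk _] := dim_up (le_refl k).
have [|c /peirceP[kc ck] rd] := factor_left dE dcan (etrans dkk (esym dbk)) (y := r * d).
  by apply/peirceP; rewrite mulrA br -mulrA dk.
exists c; apply/subr0_eq; apply: dcan; first by rewrite mulrBr !mulrA kp kc.
by rewrite mulrBr !mulrA dpa mulrA rd subrr.
Qed.

Lemma path_commutes j i k pup pdown x :
  up_path le e arr j i pup -> down_path le e arr i k pdown ->
  e j * x * e j = x -> exists c, pdown * pup * x = c * (pdown * pup).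
Proof.
move=> /up_path_cancel[ji upE upcan] /down_path_cancel[ki downE downcan] /peirceP[jx xj].
have [le_refl _ _] := le_po.
have [dij _] := dim_up ji; have [dii _] := dim_up (le_refl i).
have /peirceP[iup upj] := upE.
have [|a aE upx] := factor_right upE upcan (etrans dii (esym dij)) (y := pup * x).
  by apply/peirceP; rewrite mulrA iup -mulrA xj.
have [c da] := down_commutes ki downE downcan aE.
by exists c; rewrite -mulrA upx !mulrA da.
Qed.

End Quiver.

(** * Endomorphisms of P(j) *)

Theorem theorem2p1 (K : closedFieldType) (A : falgType K) (n : nat)
    (le : rel 'I_n) (e : 'I_n -> A) (J : {vspace A})
    (arr : 'I_n -> 'I_n -> seq A) :
  one_quasi_hereditary le e J arr ->
  forall j k i : 'I_n, le j i -> le k i ->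
  forall pup pdown : A,
    up_path le e arr j i pup -> down_path le e arr i k pdown ->
  forall F : 'End(A), is_hom (@lact K A) (@lact K A) (Pr e j) 0%VS (Pr e j) 0%VS F ->
    (F @: Amul (pdown * pup)%R <= Amul (pdown * pup)%R)%VS.
Proof.
move=> [le_po presented [Ustd [Nab [b [top [[std _ qh] bounds mult1 socles _]]]]]].
move=> j k i _ _ pup pdown upP downP F [FP [_ Fhom]].
have le_bot l : le b l by case: (bounds l).
have dimE l m := dim_peirce presented l m le_po std qh mult1.
have lsoc l := left_socle presented (socles l).1.
have rsoc l := right_socle presented (socles l).2.
have ejP : e j \in Pr e j by apply/(mem_Pr presented); rewrite (idem_vertex presented).
have FM a x : x \in Pr e j -> F (a * x) = a * F x.
  by move=> /(Fhom a); rewrite memv0 subr_eq0 !lactE => /eqP.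
have xE : e j * F (e j) * e j = F (e j).
  apply/(peirceP presented); split.
    by rewrite -FM // (idem_vertex presented).
  by apply/(mem_Pr presented)/(subvP FP); rewrite memv_img.
have [c cE] := path_commutes presented le_po le_bot dimE lsoc rsoc upP downP xE.
have [_ /(peirceP presented)[_ upj] _] :=
  up_path_cancel presented le_po le_bot dimE lsoc rsoc upP.
apply/subvP => _ /memv_imgP[_ /memv_imgP[a _ ->] ->]; apply/memv_imgP.
(* With [q = pdown] and [p = pup]: [F (a q p) = a q p F(e_j) = a c q p]. *)
exists (a * c); first exact: memvf.
by rewrite !rmulE -{1}upj !mulrA FM // -!mulrA (mulrA pdown) cE.
Qed.
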